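(* For every $n = 3m$, where $m$ is a positive integer, there exists a planar triangulation with $n$ vertices whose oriented diameter is at least $n/3$.
   Context: A planar triangulation is a plane graph with at least three vertices in which every face, including the outer face, is bounded by exactly three vertices. An orientation of an undirected graph assigns a direction to each edge; it is strongly connected if every vertex can reach every other vertex by a directed path. The diameter of a directed graph is the maximum, over all ordered pairs of vertices, of the shortest directed path distance, measured in number of edges. The oriented diameter of an undirected graph $G$ is the minimum diameter over all strongly connected orientations of $G$. *)

(* Defs.v *)
From HB Require Import structures.
From mathcomp Require Import all_boot all_order all_algebra.
From mathcomp Require Import all_classical all_reals all_analysis.

Set Implicit Arguments.
Unset Strict Implicit.
Unset Printing Implicit Defensive.

Import Order.TTheory GRing.Theory Num.Theory.
Import numFieldNormedType.Exports.

(** ** Oriented diameter *)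

Section OrientedDiameter.
Local Open Scope nat_scope.
Variable V : finType.

Definition orientation (e o : rel V) : Prop :=
  (forall u v, o u v -> e u v) /\ (forall u v, e u v -> o u v (+) o v u).

Definition strongly_connected (o : rel V) : Prop :=
  forall u v, connect o u v.

(** Least length of a directed walk from [u] to [v].  A shortest walk has
    fewer than [#|V|] edges, so searching lengths below [#|V|] is enough; the
    value is [#|V|] when [v] is not reachable from [u]. *)
Definition dist (o : rel V) (u v : V) : nat :=
  find (fun k => [exists p : k.-tuple V, path o u p && (last u p == v)])
       (iota 0 #|V|).

Definition diameter (o : rel V) : nat := \max_(u : V) \max_(v : V) dist o u v.

(** Relational, so that no value is attributed to a graph without any strongly
    connected orientation. *)
Definition is_oriented_diameter (e : rel V) (d : nat) : Prop :=
  (exists o : rel V,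
     [/\ orientation e o, strongly_connected o & diameter o = d]) /\
  (forall o : rel V,
     orientation e o -> strongly_connected o -> d <= diameter o).

End OrientedDiameter.

(** ** Plane graphs *)

Section PlaneGraphs.
Local Open Scope classical_set_scope.
Local Open Scope ring_scope.
Variable R : realType.

Local Notation plane := (R * R)%type.

Definition is_arc (a b : plane) (A : set plane) : Prop :=
  exists g : R -> plane,
    [/\ {within `[0, 1], continuous g},
        {in `[0, 1] &, injective g},
        g 0 = a, g 1 = b & A = g @` `[0, 1]].

(** [edge u v] is only meaningful when [adj u v]; it includes its endpoints. *)
Record plane_graph := PlaneGraph {
  vertex :> finType;
  adj : rel vertex;
  adj_sym : symmetric adj;
  adj_irr : irreflexive adj;
  pos : vertex -> plane;
  pos_inj : injective pos;
  edge : vertex -> vertex -> set plane;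
  edgeP : forall u v, adj u v -> is_arc (pos u) (pos v) (edge u v);
  edge_sym : forall u v, adj u v -> edge u v = edge v u;
  edge_vertex : forall u v w, adj u v -> edge u v (pos w) -> w \in [:: u; v];
  edge_meet : forall u v x y, adj u v -> adj x y ->
    (x, y) \notin [:: (u, v); (v, u)] ->
    edge u v `&` edge x y `<=` range pos
}.

Definition drawing (G : plane_graph) : set plane :=
  range (@pos G) `|` [set p | exists u v : G, adj u v /\ edge u v p].

Definition is_face (G : plane_graph) (F : set plane) : Prop :=
  exists2 x, (~` drawing G) x & F = connected_component (~` drawing G) x.

Definition frontier (A : set plane) : set plane := closure A `\` interior A.

(** The frontier is required to be a 3-cycle of the graph: merely counting the
    vertices on it would also admit, e.g., the path on three vertices. *)
Definition triangular_face (G : plane_graph) (F : set plane) : Prop :=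
  exists u v w : G,
    [/\ adj u v, adj v w, adj w u &
        frontier F = edge u v `|` edge v w `|` edge w u].

Definition planar_triangulation (G : plane_graph) : Prop :=
  (3 <= #|G|)%N /\ (forall F, is_face G F -> triangular_face G F).

End PlaneGraphs.

(* Main.v *)
(** Starting from a triangle [v_0 v_1 v_2], put each new vertex
    [v_(k+3)] at the centroid of [v_k v_(k+1) v_(k+2)] and join it to these three
    vertices.  All faces stay triangles, and [v_i], [v_j] are adjacent exactly when
    [0 < |i - j| <= 3].  Hence a walk from [v_0] to [v_(3m-1)] has at least
    [(3m-1)/3] edges, i.e. at least [m], in whatever orientation; the orientation
    [i -> i+1], [i+2 -> i], [i+3 -> i] is strongly connected.

    The barycentric weights of a point in the nested triangles
    [v_k v_(k+1) v_(k+2)] (scaled to add up to twice the area) evolve linearly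
    with [k], and each edge and each face is given by equalities and inequalities
    between them.  A face is
    recognised as an open connected set that misses the drawing and whose frontier
    lies in the drawing. *)
Require Import Defs.
From mathcomp Require Import all_boot all_order all_algebra.
From mathcomp Require Import all_classical all_reals all_analysis.
From mathcomp Require Import ring lra zify.

Set Implicit Arguments.
Unset Strict Implicit.
Unset Printing Implicit Defensive.

Import Order.TTheory GRing.Theory Num.Theory.
Import numFieldNormedType.Exports.

(** * Signed areas, segments and triangles in the plane *)

Section Triangles.
Local Open Scope classical_set_scope.
Local Open Scope ring_scope.
Variable R : realType.
Local Notation plane := (R * R)%type.
Implicit Types (a b c p q : plane) (t : R) (A : set plane).

Definition lerp p q t : plane :=
  ((1 - t) * p.1 + t * q.1, (1 - t) * p.2 + t * q.2).

Definition segment p q : set plane := lerp p q @` `[0, 1].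

(** Twice the signed area of the triangle, positive in counterclockwise order. Replacing one of [a],
    [b], [c] by [p] gives the unnormalised barycentric weights of [p]. *)
Definition det a b c : R :=
  (b.1 - a.1) * (c.2 - a.2) - (b.2 - a.2) * (c.1 - a.1).

Definition centroid a b c : plane :=
  ((a.1 + b.1 + c.1) / 3%:R, (a.2 + b.2 + c.2) / 3%:R).

Definition triangle a b c : set plane :=
  [set p | [/\ 0 <= det p b c, 0 <= det a p c & 0 <= det a b p]].

Definition open_triangle a b c : set plane :=
  [set p | [/\ 0 < det p b c, 0 < det a p c & 0 < det a b p]].

Definition exterior a b c : set plane := ~` triangle a b c.

Definition boundary a b c : set plane :=
  segment a b `|` segment b c `|` segment c a.

Lemma lerp_continuous p q : continuous (lerp p q).
Proof.
have aff (x y : R) : continuous (fun t : R => (1 - t) * x + t * y).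
  move=> t; apply: (@cvgD _ _ _ _ _ (fun t => (1 - t) * x) (fun t => t * y)).
    by apply: cvgMr_tmp; apply: cvgB; [exact: cvg_cst | exact: cvg_id].
  by apply: cvgMr_tmp; exact: cvg_id.
by move=> t; exact: (cvg_pair (aff _ _ t) (aff _ _ t)).
Qed.

Lemma det_continuous a b : continuous (det a b).
Proof.
move=> p; rewrite /det.
by apply: cvgB; apply: cvgM; (try exact: cvg_cst);
  (apply: cvgB; last exact: cvg_cst); first [exact: cvg_fst | exact: cvg_snd].
Qed.

Lemma det_rot a b c : det a b c = det b c a.
Proof. rewrite /det; ring. Qed.

Lemma det_sum a b c p : det p b c + det a p c + det a b p = det a b c.
Proof. rewrite /det; ring. Qed.

Lemma det_lerp a b p q t :
  det a b (lerp p q t) = (1 - t) * det a b p + t * det a b q.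
Proof. rewrite /det /lerp /=; ring. Qed.

Lemma lerp0 p q : lerp p q 0 = p.
Proof. by rewrite /lerp; case: p => x y /=; congr pair; ring. Qed.

Lemma lerp1 p q : lerp p q 1 = q.
Proof. by rewrite /lerp; case: q => x y /=; congr pair; ring. Qed.

Lemma segmentC p q : segment p q = segment q p.
Proof.
suff sub x y : segment x y `<=` segment y x by apply/seteqP; split; exact: sub.
move=> _ [t /= t01 <-]; exists (1 - t); rewrite /= ?in_itv /= in t01 *.
  by move: t01 => /andP[? ?]; apply/andP; split; lra.
by rewrite /lerp; congr pair; ring.
Qed.

Lemma segment_l p q : segment p q p.
Proof. by exists 0; rewrite ?lerp0 //= in_itv /=; apply/andP; split; lra. Qed.

Lemma segment_r p q : segment p q q.
Proof. by rewrite segmentC; exact: segment_l. Qed.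

Lemma segment_arc p q : p != q -> is_arc p q (segment p q).
Proof.
move=> neq; exists (lerp p q); split; rewrite ?lerp0 ?lerp1 //.
  by apply: continuous_subspaceT; exact: lerp_continuous.
move=> s t _ _ [e1 e2]; apply/eqP; rewrite -subr_eq0; apply: contraNT neq => st.
have h (x y : R) : (1 - s) * x + s * y = (1 - t) * x + t * y -> x = y.
  by move=> h; apply: (mulfI st); lra.
case: p q e1 e2 => [p1 p2] [q1 q2] /= e1 e2.
by rewrite (h _ _ e1) (h _ _ e2).
Qed.

Lemma det_gt0_open a b : open [set p | 0 < det a b p].
Proof.
apply: (@open_comp _ _ (det a b) [set x | 0 < x]); last exact: open_gt.
by move=> p _; exact: det_continuous.
Qed.

Lemma det_ge0_closed a b : closed [set p | 0 <= det a b p].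
Proof.
apply: (@preimage_closed _ _ (det a b) [set x | 0 <= x]); last exact: closed_ge.
by move=> p _; exact: det_continuous.
Qed.

(** Barycentric coordinates with denominators cleared; this is how a point is recovered from its
    three weights. *)
Lemma det_decomp a b c p :
  det a b c * p.1 = det p b c * a.1 + det a p c * b.1 + det a b p * c.1 /\
  det a b c * p.2 = det p b c * a.2 + det a p c * b.2 + det a b p * c.2.
Proof. by rewrite /det; split; ring. Qed.

Lemma eq_from_det a b c p q : 0 < det a b c ->
  det p b c = det q b c -> det a p c = det a q c -> det a b p = det a b q ->
  p = q.
Proof.
move=> D x y z; have [p1 p2] := det_decomp a b c p.
have [q1 q2] := det_decomp a b c q.
rewrite x y z -q1 in p1; rewrite x y z -q2 in p2.
have D0 : det a b c != 0 by rewrite gt_eqF.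
by case: p q p1 p2 {x y z q1 q2} => [u v] [u' v'] /= /(mulfI D0) -> /(mulfI D0) ->.
Qed.

Lemma segmentE a b c : 0 < det a b c ->
  segment a b = [set p | [/\ 0 <= det p b c, 0 <= det a p c & det a b p = 0]].
Proof.
move=> D; apply/seteqP; split=> [_ [t /= t01 <-] | p /= [x y z]].
  move: t01; rewrite in_itv /= => /andP[t0 t1].
  have -> : det (lerp a b t) b c = (1 - t) * det a b c.
    by rewrite /det /lerp /=; ring.
  have -> : det a (lerp a b t) c = t * det a b c.
    by rewrite /det /lerp /=; ring.
  have -> : det a b (lerp a b t) = 0 by rewrite /det /lerp /=; ring.
  by split=> //; apply: mulr_ge0; lra.
have S := det_sum a b c p; have [p1 p2] := det_decomp a b c p.
have D0 : det a b c != 0 by rewrite gt_eqF.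
(* On the line through [a] and [b] the parameter of [p] is its normalised weight at [b]. *)
have tD : det a p c / det a b c * det a b c = det a p c by rewrite divfK.
set t := det a p c / det a b c in tD.
exists t; rewrite /= ?in_itv /=.
  apply/andP; split; first by apply: divr_ge0 => //; exact: ltW.
  by rewrite ler_pdivrMr //; lra.
have h (u v w : R) : det a b c * u = det p b c * v + det a p c * w ->
    (1 - t) * v + t * w = u.
  move=> e; apply: (mulfI D0); rewrite e -tD.
  have -> : det p b c = det a b c - t * det a b c by lra.
  ring.
rewrite z !mul0r !addr0 in p1 p2.
by rewrite /lerp (h _ _ _ p1) (h _ _ _ p2); case: p {x y z S p1 p2 tD t h}.
Qed.

(** Each side is the part of the closed triangle where one weight vanishes; the rotations of [det]
    bring the three sides to the same three weights. *)
Lemma boundaryE a b c : 0 < det a b c ->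
  boundary a b c = triangle a b c `\` open_triangle a b c.
Proof.
move=> D; have D1 : 0 < det b c a by rewrite -det_rot.
have D2 : 0 < det c a b by rewrite det_rot.
rewrite /boundary (segmentE D) (segmentE D1) (segmentE D2).
apply/seteqP; split=> p; rewrite /triangle /open_triangle /=
    -(det_rot a p c) -(det_rot a b p) -(det_rot p b c)
    (det_rot p a b) (det_rot c p b) (det_rot c a p).
  by case=> [[] [? ? ?]|[? ? ?]]; (split; [split=> //; lra | case; lra]).
case=> -[x y z] nO.
have [z0|z0] := leP (det a b p) 0; first by left; left; split=> //; lra.
have [x0|x0] := leP (det p b c) 0; first by left; right; split=> //; lra.
have [y0|y0] := leP (det a p c) 0; first by right; split=> //; lra.
by case: nO.
Qed.

Lemma open_triangle_open a b c : open (open_triangle a b c).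
Proof.
have -> : open_triangle a b c = [set p | 0 < det b c p] `&`
    [set p | 0 < det c a p] `&` [set p | 0 < det a b p].
  apply/seteqP; split=> p; rewrite /open_triangle /= -(det_rot p b c) (det_rot c a p).
    by case.
  by case=> -[].
by apply: openI; [apply: openI|]; exact: det_gt0_open.
Qed.

Lemma triangle_closed a b c : closed (triangle a b c).
Proof.
have -> : triangle a b c = [set p | 0 <= det b c p] `&`
    [set p | 0 <= det c a p] `&` [set p | 0 <= det a b p].
  apply/seteqP; split=> p; rewrite /triangle /= -(det_rot p b c) (det_rot c a p).
    by case.
  by case=> -[].
by apply: closedI; [apply: closedI|]; exact: det_ge0_closed.
Qed.

Lemma exterior_open a b c : open (exterior a b c).
Proof. by apply: closed_openC; exact: triangle_closed. Qed.

(** * Connectedness by convexity *)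

Lemma convex_connected A :
  (forall p q t, A p -> A q -> 0 <= t <= 1 -> A (lerp p q t)) -> connected A.
Proof.
move=> cA; have [[p Ap]|A0] := pselect (exists p, A p); last first.
  have -> : A = set0 by apply/seteqP; split=> // p Ap; case: A0; exists p.
  exact: connected0.
(* A convex set is a union of segments, all through one fixed point [p]. *)
have -> : A = \bigcup_(q in A) segment p q.
  apply/seteqP; split=> [q Aq | _ [q Aq [t /= t01 <-]]].
    by exists q => //; exact: segment_r.
  by apply: cA => //; rewrite in_itv /= in t01.
apply: bigcup_connected; first by exists p => q _; exact: segment_l.
move=> q _; apply: connected_continuous_connected; first exact: segment_connected.
by apply: continuous_subspaceT; exact: lerp_continuous.
Qed.

Lemma convex_comb_gt0 (x y t : R) :
  0 < x -> 0 < y -> 0 <= t <= 1 -> 0 < (1 - t) * x + t * y.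
Proof.
move=> x0 y0 /andP[t0 t1].
have [->|tn0] := eqVneq t 0; first by rewrite mul0r addr0 subr0 mul1r.
have tp : 0 < t by rewrite lt_neqAle eq_sym tn0.
by apply: ltr_wpDl; [apply: mulr_ge0; lra | exact: mulr_gt0].
Qed.

Lemma open_triangle_connected a b c : connected (open_triangle a b c).
Proof.
apply: convex_connected => p q t [x y z] [x' y' z'] t01.
rewrite /open_triangle /= det_rot (det_rot a) (det_rot _ c a) !det_lerp.
rewrite det_rot in x; rewrite det_rot in x'.
rewrite -det_rot in y; rewrite -det_rot in y'.
by split; exact: convex_comb_gt0.
Qed.

Lemma half_plane_connected a b : connected [set p | det a b p < 0].
Proof.
apply: convex_connected => p q t /= x x' t01; rewrite det_lerp -oppr_gt0.
by rewrite opprD -!mulrN; apply: convex_comb_gt0; rewrite ?oppr_gt0.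
Qed.

Lemma exteriorE a b c : exterior a b c =
  [set p | det a b p < 0] `|` [set p | det b c p < 0] `|` [set p | det c a p < 0].
Proof.
apply/seteqP; split=> p;
    rewrite /exterior /triangle /= (det_rot p b c) -(det_rot c a p).
  move=> nT; have [z|z] := ltP (det a b p) 0; first by left; left.
  have [x|x] := ltP (det b c p) 0; first by left; right.
  have [y|y] := ltP (det c a p) 0; first by right.
  by case: nT.
by case=> [[]|] ? []; lra.
Qed.

(** The exterior is the union of three half-planes, glued one after the other along nonempty
    overlaps. *)
Lemma exterior_connected a b c : 0 < det a b c -> connected (exterior a b c).
Proof.
move=> D; rewrite exteriorE.
have wedge (u v w : plane) : 0 < det u v w ->
    [set p | det u v p < 0] `&` [set p | det v w p < 0] !=set0.
  (* The point [v + (v - u) + (v - w)] lies beyond the corner [v], on the outer side of both lines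
     through it. *)
  move=> D'; exists (3%:R * v.1 - u.1 - w.1, 3%:R * v.2 - u.2 - w.2).
  have e1 : det u v (3%:R * v.1 - u.1 - w.1, 3%:R * v.2 - u.2 - w.2) = - det u v w.
    by rewrite /det /=; ring.
  have e2 : det v w (3%:R * v.1 - u.1 - w.1, 3%:R * v.2 - u.2 - w.2) = - det u v w.
    by rewrite /det /=; ring.
  by rewrite /= e1 e2; split; lra.
apply: connectedU; last exact: half_plane_connected.
  have [|p [/= x y]] := wedge b c a; first by rewrite -det_rot.
  by exists p; split => //; right.
by apply: connectedU; [exact: wedge | |]; exact: half_plane_connected.
Qed.

(** * Closures and frontiers of triangles and their exteriors *)

Lemma closure_lerp A p q :
  (forall t, 0 < t <= 1 -> A (lerp p q t)) -> closure A p.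
Proof.
move=> Aq B Bp.
have /nbhs_ballP[e /= e0 eB] : nbhs (0 : R) (lerp p q @^-1` B).
  by apply: lerp_continuous; rewrite lerp0.
(* Small enough to stay in the ball of radius [e], and capped at 1 to stay on the segment. *)
pose t : R := Num.min (e / 2%:R) 1.
have t0 : 0 < t by rewrite lt_min ltr01 andbT divr_gt0.
have t1 : t <= 1 by rewrite ge_min lexx orbT.
have te : t < e.
  have : t <= e / 2%:R by rewrite ge_min lexx.
  have : 0 < e by [].
  lra.
exists (lerp p q t); split; first by apply: Aq; rewrite t0.
by apply: eB; rewrite /ball /= sub0r normrN gtr0_norm.
Qed.

Lemma convex_comb_ge0_gt0 (x y t : R) :
  0 <= x -> 0 < y -> 0 < t <= 1 -> 0 < (1 - t) * x + t * y.
Proof.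
move=> x0 y0 /andP[t0 t1].
by apply: ltr_wpDl; [apply: mulr_ge0; lra | exact: mulr_gt0].
Qed.

Lemma frontier_open A : open A -> frontier A = closure A `\` A.
Proof. by move=> /interior_id oA; rewrite /frontier oA. Qed.

Lemma open_triangle_sub a b c : open_triangle a b c `<=` triangle a b c.
Proof. by move=> p [x y z]; split; exact: ltW. Qed.

Lemma open_triangle_frontier a b c : 0 < det a b c ->
  frontier (open_triangle a b c) = boundary a b c.
Proof.
move=> D; rewrite frontier_open; last exact: open_triangle_open.
rewrite boundaryE //; congr (_ `\` _); apply/seteqP; split.
  rewrite [X in _ `<=` X]((closure_id _).1 (@triangle_closed a b c)).
  exact: closureS (@open_triangle_sub a b c).
(* Moving from a point of the closed triangle towards the centroid, whose weights are all positive,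
   enters the open triangle at once. *)
move=> p [x y z]; apply: (@closure_lerp _ _ (centroid a b c)) => t t01.
rewrite /open_triangle /= det_rot (det_rot a) (det_rot _ c a) !det_lerp.
have e1 : det b c (centroid a b c) = det a b c / 3%:R by rewrite /det /centroid /=; field.
have e2 : det c a (centroid a b c) = det a b c / 3%:R by rewrite /det /centroid /=; field.
have e3 : det a b (centroid a b c) = det a b c / 3%:R by rewrite /det /centroid /=; field.
rewrite e1 e2 e3 -(det_rot p b) (det_rot c a).
have D3 : 0 < det a b c / 3%:R by apply: divr_gt0.
by split; exact: convex_comb_ge0_gt0.
Qed.

Lemma exterior_frontier a b c : 0 < det a b c ->
  frontier (exterior a b c) = boundary a b c.
Proof.
move=> D; rewrite frontier_open; last exact: exterior_open.
rewrite boundaryE //; apply/seteqP; split=> p [].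
  move=> cE nE; have T : triangle a b c p by apply: contrapT.
  split=> // Op.
  have oO := @open_triangle_open a b c.
  have [q [Eq Oq]] := cE _ (open_nbhs_nbhs (conj oO Op)).
  by apply: Eq; exact: open_triangle_sub.
move=> T nO; split; last by move=> /(_ T).
have out (u v w : plane) : 0 < det u v w -> det u v p = 0 ->
    closure [set p | det u v p < 0] p.
  (* The target is the reflection of [w] in the midpoint of [u] and [v]; its weight against the side
     [u v] is the opposite of that of [w]. *)
  move=> D' z; apply: (@closure_lerp _ _ (u.1 + v.1 - w.1, u.2 + v.2 - w.2)).
  move=> t /andP[t0 _]; rewrite /= det_lerp z mulr0 add0r.
  have -> : det u v (u.1 + v.1 - w.1, u.2 + v.2 - w.2) = - det u v w.
    by rewrite /det /=; ring.
  by rewrite mulrN oppr_lt0 mulr_gt0.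
have [x y z] := T; rewrite exteriorE !closureU.
have [z0|z0] := leP (det a b p) 0.
  by left; left; apply: (out a b c) => //; lra.
have [x0|x0] := leP (det p b c) 0.
  by left; right; apply: (out b c a); rewrite -det_rot //; lra.
have [y0|y0] := leP (det a p c) 0.
  by right; apply: (out c a b); rewrite det_rot //; lra.
by case: nO.
Qed.

End Triangles.

(** * Recognising a connected component *)

Section Components.
Local Open Scope classical_set_scope.

(** For a connected [C] inside [A] that contains [x], the trace of [U] on [C] is open in [C], and
    also closed in [C] since it equals the trace of [closure U]. Being nonempty, it is all of
    [C]. *)
Lemma connected_component_eq (T : topologicalType) (A U : set T) x :
  open U -> connected U -> U `<=` A -> closure U `&` A `<=` U -> U x ->
  connected_component A x = U.
Proof.
move=> oU cU UA clU Ux; apply/seteqP; split; last exact: connected_component_max.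
move=> y [C [Cx CA cC] Cy].
suff e : C `&` U = C by move: Cy; rewrite -e => -[].
apply: cC; [by exists x | by exists U |].
exists (closure U); first exact: closed_closure.
apply/seteqP; split=> z [Cz Uz]; split=> //; first exact: subset_closure.
by apply: clU; split=> //; exact: CA.
Qed.

End Components.

(** * The nested triangles and their barycentric weights *)

Section StackedTriangles.
Local Open Scope classical_set_scope.
Local Open Scope ring_scope.
Variable R : realType.
Local Notation plane := (R * R)%type.
Implicit Types (p q : plane) (i j k n : nat).

(** The state carries three consecutive vertices, so that the third-order recurrence becomes a
    structural recursion. *)
Fixpoint stack k : plane * plane * plane :=
  if k is k'.+1 then
    let: (a, b, c) := stack k' in (b, c, centroid a b c)
  else ((0, 0), (1, 0), (0, 1)).

Definition vert k : plane := (stack k).1.1.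

Lemma stackE k : stack k = (vert k, vert k.+1, vert k.+2).
Proof. by rewrite /vert /=; case: (stack k) => -[]. Qed.

Lemma vert3E k : vert k.+3 = centroid (vert k) (vert k.+1) (vert k.+2).
Proof. by rewrite {1}/vert /=; rewrite stackE. Qed.

Definition weightA k p := det p (vert k.+1) (vert k.+2).
Definition weightB k p := det (vert k) p (vert k.+2).
Definition weightC k p := det (vert k) (vert k.+1) p.
Definition area k := det (vert k) (vert k.+1) (vert k.+2).

(** Substituting [v_k = 3 v_(k+3) - v_(k+1) - v_(k+2)] in the barycentric expansion turns the
    weights [A, B, C] into [B - A, C - A, 3A]; the division by 3 is the ratio of the areas. *)
Lemma weightAS k p : weightA k.+1 p = (weightB k p - weightA k p) / 3%:R.
Proof. by rewrite /weightA /weightB vert3E /det /centroid /=; field. Qed.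

Lemma weightBS k p : weightB k.+1 p = (weightC k p - weightA k p) / 3%:R.
Proof. by rewrite /weightA /weightB /weightC vert3E /det /centroid /=; field. Qed.

Lemma weightCS k p : weightC k.+1 p = weightA k p.
Proof. by rewrite /weightA /weightC -det_rot. Qed.

Lemma sum_weights k p : weightA k p + weightB k p + weightC k p = area k.
Proof. exact: det_sum. Qed.

Lemma area_gt0 k : 0 < area k.
Proof.
elim: k => [|k IH].
  rewrite /area /det /= /centroid /=; lra.
(* The weights of any point add up to the area; evaluating at the origin shows that each area is a
   third of the preceding one. *)
rewrite -(sum_weights _ 0) weightAS weightBS weightCS; have := sum_weights k 0; lra.
Qed.

Lemma weights_inj k p q :
  weightA k p = weightA k q -> weightB k p = weightB k q ->
  weightC k p = weightC k q -> p = q.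
Proof. exact: (eq_from_det (area_gt0 k)). Qed.

Lemma vert_coord0 k :
  [/\ weightA k (vert k) = area k, weightB k (vert k) = 0 & weightC k (vert k) = 0].
Proof. by split; rewrite // /weightB /weightC /det; ring. Qed.

Lemma vert_coord1 k :
  [/\ weightA k (vert k.+1) = 0, weightB k (vert k.+1) = area k & weightC k (vert k.+1) = 0].
Proof. by split; rewrite // /weightA /weightC /det; ring. Qed.

Lemma vert_coord2 k :
  [/\ weightA k (vert k.+2) = 0, weightB k (vert k.+2) = 0 & weightC k (vert k.+2) = area k].
Proof. by split; rewrite // /weightA /weightB /det; ring. Qed.

Lemma vert_coord3 k : [/\ weightA k (vert k.+3) = area k / 3%:R,
  weightB k (vert k.+3) = area k / 3%:R & weightC k (vert k.+3) = area k / 3%:R].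
Proof.
by split; rewrite vert3E /weightA /weightB /weightC /area /det /centroid /=; field.
Qed.

(** * Edges and faces described by weights *)

Definition stack_triangle k := triangle (vert k) (vert k.+1) (vert k.+2).
Definition inner k := open_triangle (vert k) (vert k.+1) (vert k.+2).
(** The vertex [v_(k+3)] cuts [inner k] into three pieces, according to the strictly least weight:
    [weightC] on [left_face k], [weightB] on [right_face k], [weightA] on [inner k.+1]. Only the
    last piece is subdivided again. *)
Definition left_face k := open_triangle (vert k) (vert k.+1) (vert k.+3).
Definition right_face k := open_triangle (vert k) (vert k.+3) (vert k.+2).

Lemma stack_triangleE k p : stack_triangle k p <->
  [/\ 0 <= weightA k p, 0 <= weightB k p & 0 <= weightC k p].
Proof. by []. Qed.

Lemma innerE k p : inner k p <->
  [/\ 0 < weightA k p, 0 < weightB k p & 0 < weightC k p].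
Proof. by []. Qed.

Lemma left_area k : det (vert k) (vert k.+1) (vert k.+3) = area k / 3%:R.
Proof. by have [] := vert_coord3 k. Qed.

Lemma right_area k : det (vert k) (vert k.+3) (vert k.+2) = area k / 3%:R.
Proof. by have [] := vert_coord3 k. Qed.

Lemma left_faceE k p : left_face k p <->
  [/\ 0 < weightC k p, weightC k p < weightA k p & weightC k p < weightB k p].
Proof.
rewrite /left_face /open_triangle /= -/(weightC k p).
have -> : det p (vert k.+1) (vert k.+3) = (weightA k p - weightC k p) / 3%:R.
  by rewrite vert3E /weightA /weightC /det /centroid /=; field.
have -> : det (vert k) p (vert k.+3) = (weightB k p - weightC k p) / 3%:R.
  by rewrite vert3E /weightB /weightC /det /centroid /=; field.
by split=> -[? ? ?]; split; lra.
Qed.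

Lemma right_faceE k p : right_face k p <->
  [/\ 0 < weightB k p, weightB k p < weightA k p & weightB k p < weightC k p].
Proof.
rewrite /right_face /open_triangle /= -/(weightB k p).
have -> : det p (vert k.+3) (vert k.+2) = (weightA k p - weightB k p) / 3%:R.
  by rewrite vert3E /weightA /weightB /det /centroid /=; field.
have -> : det (vert k) (vert k.+3) p = (weightC k p - weightB k p) / 3%:R.
  by rewrite vert3E /weightB /weightC /det /centroid /=; field.
by split=> -[? ? ?]; split; lra.
Qed.

Lemma segment1E k p : segment (vert k) (vert k.+1) p <->
  [/\ 0 <= weightA k p, 0 <= weightB k p & weightC k p = 0].
Proof. by rewrite (segmentE (area_gt0 k)). Qed.

Lemma segment2E k p : segment (vert k) (vert k.+2) p <->
  [/\ 0 <= weightA k p, weightB k p = 0 & 0 <= weightC k p].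
Proof.
have D : 0 < det (vert k.+2) (vert k) (vert k.+1) by rewrite det_rot area_gt0.
rewrite segmentC (segmentE D) /= (det_rot p (vert k)) (det_rot _ p (vert k.+1)).
by rewrite (det_rot (vert k.+2) (vert k) p); split=> -[].
Qed.

Lemma segment3E k p : segment (vert k) (vert k.+3) p <->
  [/\ 0 <= weightB k p, weightB k p <= weightA k p & weightC k p = weightB k p].
Proof.
have D : 0 < det (vert k) (vert k.+3) (vert k.+2).
  by rewrite right_area; have := area_gt0 k; lra.
rewrite (segmentE D) /= -/(weightB k p).
have -> : det p (vert k.+3) (vert k.+2) = (weightA k p - weightB k p) / 3%:R.
  by rewrite vert3E /weightA /weightB /det /centroid /=; field.
have -> : det (vert k) (vert k.+3) p = (weightC k p - weightB k p) / 3%:R.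
  by rewrite vert3E /weightB /weightC /det /centroid /=; field.
by split=> -[? ? ?]; split; lra.
Qed.

(** * Nesting of the triangles and planarity of the edges *)

Lemma near_cases i j : (i < j <= i + 3)%N -> [\/ j = i.+1, j = i.+2 | j = i.+3].
Proof.
move=> h; have [->|h1] := eqVneq j i.+1; first exact: Or31.
have [->|h2] := eqVneq j i.+2; first exact: Or32.
by apply: Or33; lia.
Qed.

Lemma stack_triangleS k p : stack_triangle k.+1 p <->
  [/\ 0 <= weightA k p, weightA k p <= weightB k p & weightA k p <= weightC k p].
Proof.
by rewrite stack_triangleE weightAS weightBS weightCS; split=> -[? ? ?]; split; lra.
Qed.

Lemma innerS k p : inner k.+1 p <->
  [/\ 0 < weightA k p, weightA k p < weightB k p & weightA k p < weightC k p].
Proof. by rewrite innerE weightAS weightBS weightCS; split=> -[? ? ?]; split; lra. Qed.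

Lemma stack_triangle_nest i j : (i <= j)%N -> stack_triangle j `<=` stack_triangle i.
Proof.
move=> /subnK <-; elim: (j - i)%N => // d IH p; rewrite addSn => /stack_triangleS [? ? ?].
by apply: IH; apply/stack_triangleE; split; lra.
Qed.

Lemma inner_nest i j : (i <= j)%N -> inner j `<=` inner i.
Proof.
move=> /subnK <-; elim: (j - i)%N => // d IH p; rewrite addSn => /innerS [? ? ?].
by apply: IH; apply/innerE; split; lra.
Qed.

Lemma segment_stack_triangle i j : (i < j <= i + 3)%N ->
  segment (vert i) (vert j) `<=` stack_triangle i.
Proof.
by move=> /near_cases[] -> p; rewrite ?segment1E ?segment2E ?segment3E stack_triangleE
  => -[? ? ?]; split; lra.
Qed.

Lemma vert_stack_triangle i j : (i <= j)%N -> stack_triangle i (vert j).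
Proof.
move=> ij; apply: (stack_triangle_nest ij); apply/stack_triangleE.
have [-> -> ->] := vert_coord0 j.
by split=> //; exact/ltW/area_gt0.
Qed.

(** At [vert i] the weight [weightA i] is the full area, whereas in all later triangles it is the
    least of the three. *)
Lemma vert_notin_stack_triangle i j : (i < j)%N -> ~ stack_triangle j (vert i).
Proof.
move=> ij Tj; have /stack_triangleS := stack_triangle_nest ij Tj.
by have [-> -> ->] := vert_coord0 i => -[]; have := area_gt0 i; lra.
Qed.

Lemma vert_inj : injective vert.
Proof.
move=> i j e; case: (ltngtP i j) => // ij; case: (vert_notin_stack_triangle ij).
  by rewrite e; exact: vert_stack_triangle.
by rewrite -e; exact: vert_stack_triangle.
Qed.

(** In the triangle [i + 1] the weight [weightA i] is least; together with the equality that defines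
    the edge, this forces the weights of [vert j]. Non-crossing of edges rests on this. *)
Lemma segment_inner_end i j p : (i < j <= i + 3)%N ->
  segment (vert i) (vert j) p -> stack_triangle i.+1 p -> p = vert j.
Proof.
have S := sum_weights i p.
move=> /near_cases[] -> + /stack_triangleS; rewrite ?segment1E ?segment2E ?segment3E
  => -[? ? ?] [? ? ?]; apply: (@weights_inj i);
  have [a1 a2 a3] := vert_coord1 i; have [b1 b2 b3] := vert_coord2 i;
  have [c1 c2 c3] := vert_coord3 i; lra.
Qed.

Lemma segment_vert i j k : (i < j <= i + 3)%N ->
  segment (vert i) (vert j) (vert k) -> k = i \/ k = j.
Proof.
move=> ij s; case: (ltngtP k i) => [ki|ik|->]; last by left.
  by case: (vert_notin_stack_triangle ki); exact: (segment_stack_triangle ij).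
by right; apply: vert_inj; apply: (segment_inner_end ij s); exact: vert_stack_triangle.
Qed.

(** Of two edges with different lower indices, the one with the larger lower index lies in the
    triangle following the start of the other, so they can meet only at the upper end of that other
    edge. Edges with the same start share only that start. *)
Lemma segment_meet i j k l p : (i < j <= i + 3)%N -> (k < l <= k + 3)%N ->
  (i, j) != (k, l) -> segment (vert i) (vert j) p -> segment (vert k) (vert l) p ->
  p = vert i \/ p = vert j \/ p = vert l.
Proof.
move=> ij kl ne s s'; case: (ltngtP i k) => [ik|ki|e].
- right; left; apply: (segment_inner_end ij s).
  by apply: (stack_triangle_nest ik); exact: (segment_stack_triangle kl).
- right; right; apply: (segment_inner_end kl s').
  by apply: (stack_triangle_nest ki); exact: (segment_stack_triangle ij).
left; subst k; have [a1 a2 a3] := vert_coord0 i; have S := sum_weights i p.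
move: ne s s'.
by case: (near_cases ij) => ->; case: (near_cases kl) => ->; rewrite ?eqxx //= => _;
  rewrite ?segment1E ?segment2E ?segment3E => -[? ? ?] [? ? ?];
  apply: (@weights_inj i); lra.
Qed.

(** * Faces miss the edges, and together they cover the complement *)

Lemma left_face_segment i j k p : (i < j <= i + 3)%N -> left_face k p ->
  ~ segment (vert i) (vert j) p.
Proof.
(* Edges starting earlier miss [inner i.+1], which contains the face; edges starting later lie in
   the closed triangle [k + 1], where [weightA k] is least; edges starting at [vert k] are compared
   directly. *)
move=> ij /left_faceE [z0 zx zy] s; case: (ltngtP i k) => [ik|ki|e].
- have : inner k p by apply/innerE; split; lra.
  move/(inner_nest ik)/innerS => [? ? ?]; move: s.
  by case: (near_cases ij) => ->; rewrite ?segment1E ?segment2E ?segment3E; case; lra.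
- by have /stack_triangleS[] := stack_triangle_nest ki (segment_stack_triangle ij s); lra.
by move: s; rewrite e; subst i;
  case: (near_cases ij) => ->; rewrite ?segment1E ?segment2E ?segment3E; case; lra.
Qed.

Lemma right_face_segment i j k p : (i < j <= i + 3)%N -> right_face k p ->
  ~ segment (vert i) (vert j) p.
Proof.
move=> ij /right_faceE [z0 zx zy] s; case: (ltngtP i k) => [ik|ki|e].
- have : inner k p by apply/innerE; split; lra.
  move/(inner_nest ik)/innerS => [? ? ?]; move: s.
  by case: (near_cases ij) => ->; rewrite ?segment1E ?segment2E ?segment3E; case; lra.
- by have /stack_triangleS[] := stack_triangle_nest ki (segment_stack_triangle ij s); lra.
by move: s; rewrite e; subst i;
  case: (near_cases ij) => ->; rewrite ?segment1E ?segment2E ?segment3E; case; lra.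
Qed.

Lemma inner_segment i j k p : (i < j <= i + 3)%N -> (j <= k + 2)%N -> inner k p ->
  ~ segment (vert i) (vert j) p.
Proof.
move=> ij jk Op s; case: (ltngtP i k) => [ik|ki|e].
- move: Op => /(inner_nest ik)/innerS => -[? ? ?]; move: s.
  by case: (near_cases ij) => ->; rewrite ?segment1E ?segment2E ?segment3E; case; lra.
(* The bound on [j] leaves only the side opposite [vert k], where [weightA k] vanishes. *)
- have [ei ej] : i = k.+1 /\ j = i.+1 by lia.
  move: s; rewrite ej ei segment1E weightCS; move: Op => /innerE [? ? ?] []; lra.
subst k; move: Op s => /innerE [? ? ?].
have [->|->] : j = i.+1 \/ j = i.+2 by lia.
  by rewrite segment1E; case; lra.
by rewrite segment2E; case; lra.
Qed.

(** A point off all edges and inside the first triangle is followed inwards: at each stage its least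
    weight selects one of the three pieces, and a tie for the least weight would put it on an edge
    to [vert k.+3]. *)
Lemma face_cover n p : (3 <= n)%N ->
  (forall i j, (i < j <= i + 3)%N -> (j < n)%N -> ~ segment (vert i) (vert j) p) ->
  [\/ exterior (vert 0) (vert 1) (vert 2) p,
      exists2 k, (k + 3 < n)%N & left_face k p \/ right_face k p |
      inner (n - 3) p].
Proof.
move=> n3 nS.
have [T0|] := pselect (stack_triangle 0 p); last by move=> ?; apply: Or31.
have O0 : inner 0 p.
  have [a b c] := T0; apply: contrapT => nO.
  have : boundary (vert 0) (vert 1) (vert 2) p.
    by rewrite boundaryE //; exact: (area_gt0 0).
  rewrite /boundary (segmentC (vert 2)).
  by case=> [[]|]; apply: nS; lia.
have [|nF] := pselect (exists2 k, (k + 3 < n)%N & left_face k p \/ right_face k p).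
  by move=> ?; apply: Or32.
apply: Or33.
have : forall k, (k + 3 <= n)%N -> inner k p.
  elim=> // k IH kn; have /innerE [x y z] : inner k p by apply: IH; lia.
  have nl : ~ left_face k p by move=> ?; apply: nF; exists k; [lia | left].
  have nr : ~ right_face k p by move=> ?; apply: nF; exists k; [lia | right].
  have s3 : ~ segment (vert k) (vert k.+3) p by apply: nS; lia.
  have s2 : ~ segment (vert k.+1) (vert k.+3) p by apply: nS; lia.
  have s1 : ~ segment (vert k.+2) (vert k.+3) p by apply: nS; lia.
  have {}nl : ~ [/\ 0 < weightC k p, weightC k p < weightA k p & weightC k p < weightB k p].
    by move/left_faceE.
  have {}nr : ~ [/\ 0 < weightB k p, weightB k p < weightA k p & weightB k p < weightC k p].
    by move/right_faceE.
  apply/innerS; split=> //; rewrite ltNge; apply/negP => le.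
    have [yz|zy|yz] := ltgtP (weightB k p) (weightC k p).
    - have [ltx|lex] := ltP (weightB k p) (weightA k p); first by apply: nr.
      by apply: s1; apply/segment1E; rewrite !(weightAS, weightBS, weightCS); split; lra.
    - by apply: nl; split; lra.
    - by apply: s3; apply/segment3E; split; lra.
  have [yz|zy|yz] := ltgtP (weightB k p) (weightC k p).
  - by apply: nr; split; lra.
  - have [ltx|lex] := ltP (weightC k p) (weightA k p); first by apply: nl.
    by apply: s2; apply/segment2E; rewrite !(weightAS, weightBS, weightCS); split; lra.
  - by apply: s3; apply/segment3E; split; lra.
by apply; lia.
Qed.

End StackedTriangles.

(** * The plane graph and its triangular faces *)

Definition near (i j : nat) : bool := [&& i != j, i <= j + 3 & j <= i + 3].

Lemma nearC : symmetric near.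
Proof. by move=> i j; rewrite /near; lia. Qed.

Lemma nearP i j : near i j -> (i < j <= i + 3) || (j < i <= j + 3).
Proof. by rewrite /near; lia. Qed.

Section StackGraph.
Local Open Scope classical_set_scope.
Variables (R : realType) (n : nat).
Implicit Types u v w x y : 'I_n.

Definition stack_pos u : R * R := vert R u.
Definition stack_edge u v : set (R * R) := segment (stack_pos u) (stack_pos v).
Definition stack_adj : rel 'I_n := fun u v => near u v.

Lemma stack_adj_sym : symmetric stack_adj.
Proof. by move=> u v; exact: nearC. Qed.

Lemma stack_adj_irr : irreflexive stack_adj.
Proof. by move=> u; rewrite /stack_adj /near eqxx. Qed.

Lemma stack_pos_inj : injective stack_pos.
Proof. by move=> u v /vert_inj /val_inj. Qed.

Lemma stack_edgeP u v : stack_adj u v ->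
  is_arc (stack_pos u) (stack_pos v) (stack_edge u v).
Proof.
move=> /and3P[uv _ _]; apply: segment_arc; apply: contra uv => /eqP.
by move=> /stack_pos_inj ->.
Qed.

Lemma stack_edge_sym u v : stack_adj u v -> stack_edge u v = stack_edge v u.
Proof. by move=> _; exact: segmentC. Qed.

Lemma stack_edge_vertex u v w : stack_adj u v -> stack_edge u v (stack_pos w) ->
  w \in [:: u; v].
Proof.
move=> /nearP /orP[] uv; rewrite /stack_edge ?inE.
  by move=> /(segment_vert uv)[] e; rewrite -!(inj_eq val_inj) /= e eqxx ?orbT.
rewrite segmentC.
by move=> /(segment_vert uv)[] e; rewrite -!(inj_eq val_inj) /= e eqxx ?orbT.
Qed.

Lemma stack_edge_meet u v x y : stack_adj u v -> stack_adj x y ->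
  (x, y) \notin [:: (u, v); (v, u)] ->
  stack_edge u v `&` stack_edge x y `<=` range stack_pos.
Proof.
have key (a b c d : 'I_n) p : (a < b <= a + 3)%N -> (c < d <= c + 3)%N ->
    (c, d) != (a, b) -> stack_edge a b p -> stack_edge c d p -> range stack_pos p.
  move=> ab cd ne s t; have [|->|[->|->]] := segment_meet ab cd _ s t; last 3 first.
  - by exists a.
  - by exists b.
  - by exists d.
  - by apply: contra ne => /eqP[e1 e2]; rewrite xpair_eqE
      -!(inj_eq val_inj) /= e1 e2 !eqxx.
move=> /nearP uv /nearP xy; rewrite !inE negb_or => /andP[ne1 ne2] p [].
rewrite /stack_edge.
case/orP: uv => uv; case/orP: xy => xy.
- exact: key.
- rewrite (segmentC (stack_pos x)); apply: key => //.
  by apply: contra ne2 => /eqP[-> ->].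
- rewrite (segmentC (stack_pos u)); exact: key.
- rewrite (segmentC (stack_pos x)) (segmentC (stack_pos u)); apply: key => //.
  by apply: contra ne1 => /eqP[-> ->].
Qed.

Definition stack_graph : plane_graph R :=
  PlaneGraph stack_adj_sym stack_adj_irr stack_pos_inj stack_edgeP
    stack_edge_sym stack_edge_vertex stack_edge_meet.

Hypothesis n_ge3 : 3 <= n.

Lemma drawing_segment i j p : i < j <= i + 3 -> j < n ->
  segment (vert R i) (vert R j) p -> drawing stack_graph p.
Proof.
move=> ij jn s; have iltn : i < n by lia.
right; exists (Ordinal iltn), (Ordinal jn); split=> //.
by rewrite /= /stack_adj /near /=; lia.
Qed.

Lemma drawingP p : drawing stack_graph p -> exists i j,
  [/\ i < j <= i + 3, j < n & segment (vert R i) (vert R j) p].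
Proof.
case=> [[u _ <-]|[u [v [/nearP/orP[] uv s]]]].
(* Every vertex is an end of some edge, to its successor or, for the last vertex, to its
   predecessor; so the drawing is just the union of the segments. *)
- have [un|un] := ltnP u.+1 n.
    by exists u, u.+1; split; [lia | | exact: segment_l].
  have := ltn_ord u => un'.
  by exists u.-1, u; split; [lia | | exact: segment_r].
- by exists u, v; split.
- by exists v, u; split=> //; rewrite segmentC.
Qed.

(** The frontier of [U] consists of edges, so [U] is relatively closed in the complement of the
    drawing, hence a whole component of it. *)
Lemma triangular_faceP i j k (U : set (R * R)) p :
  near i j -> near j k -> near k i -> i < n -> j < n -> k < n ->
  open U -> connected U -> frontier U = boundary (vert R i) (vert R j) (vert R k) ->
  (forall i j q, i < j <= i + 3 -> j < n -> U q -> ~ segment (vert R i) (vert R j) q) ->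
  U p -> triangular_face stack_graph (connected_component (~` drawing stack_graph) p).
Proof.
move=> ij jk ki iltn jltn kltn oU cU fU UD Up.
have bD : boundary (vert R i) (vert R j) (vert R k) `<=` drawing stack_graph.
  have E (a b : nat) (an : a < n) (bn : b < n) : near a b ->
      segment (vert R a) (vert R b) `<=` drawing stack_graph.
    by move=> ab q s; right; exists (Ordinal an), (Ordinal bn).
  by move=> q [[]|]; apply: E.
rewrite (connected_component_eq oU cU _ _ Up).
- exists (Ordinal iltn), (Ordinal jltn), (Ordinal kltn); split=> //.
- by move=> q Uq /drawingP[a [b [ab bn]]]; exact: UD Uq.
move=> q [cq nD]; apply: contrapT => nU; apply: nD; apply: bD.
by rewrite -fU frontier_open.
Qed.

Lemma stack_triangulation : planar_triangulation stack_graph.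
Proof.
split; first by rewrite card_ord.
move=> F [p nD ->].
have [|Ep|[k kn [Lp|Rp]]|Ip] := @face_cover R n p n_ge3.
- by move=> i j ij jn s; apply: nD; exact: drawing_segment s.
- apply: (@triangular_faceP 0 1 2 _ _ _ _ _ _ _ _ _ _ _ _ Ep); try by [|lia].
  + exact: exterior_open.
  + by apply: exterior_connected; exact: (area_gt0 R 0).
  + by apply: exterior_frontier; exact: (area_gt0 R 0).
  + move=> i j q ij _ Eq s; apply: Eq.
    by apply: (stack_triangle_nest (leq0n i)); exact: segment_stack_triangle s.
- apply: (@triangular_faceP k k.+1 k.+3 _ _ _ _ _ _ _ _ _ _ _ _ Lp);
    try by rewrite /near; lia.
  + exact: open_triangle_open.
  + exact: open_triangle_connected.
  + by apply: open_triangle_frontier; rewrite left_area divr_gt0 ?area_gt0.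
  + by move=> i j q ij _; exact: left_face_segment.
- apply: (@triangular_faceP k k.+3 k.+2 _ _ _ _ _ _ _ _ _ _ _ _ Rp);
    try by rewrite /near; lia.
  + exact: open_triangle_open.
  + exact: open_triangle_connected.
  + by apply: open_triangle_frontier; rewrite right_area divr_gt0 ?area_gt0.
  + by move=> i j q ij _; exact: right_face_segment.
- apply: (@triangular_faceP (n - 3) (n - 3).+1 (n - 3).+2 _ _ _ _ _ _ _ _ _ _ _ _ Ip);
    try by rewrite /near; lia.
  + exact: open_triangle_open.
  + exact: open_triangle_connected.
  + by apply: open_triangle_frontier; exact: area_gt0.
  (* Here [j < n] is exactly [j <= (n - 3) + 2], so no edge subdivides the innermost triangle. *)
  + by move=> i j q ij jn; apply: inner_segment => //; lia.
Qed.

End StackGraph.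

(** * A strongly connected orientation *)

Section StackOrientation.
Variable n : nat.
Hypothesis n_ge3 : 3 <= n.

Definition stack_orientation : rel 'I_n :=
  fun u v => [|| v == u.+1 :> nat, u == v.+2 :> nat | u == v.+3 :> nat].

Lemma stack_orientationP : orientation (@stack_adj n) stack_orientation.
Proof.
by split=> u v; rewrite /stack_adj /near /stack_orientation; lia.
Qed.

(** All walks are routed through vertex 0: upwards by steps of one, downwards by steps of two. *)
Lemma stack_orientation_strong : strongly_connected stack_orientation.
Proof.
have n0 : 0 < n by lia.
have up j (jn : j < n) : connect stack_orientation (Ordinal n0) (Ordinal jn).
  elim: j jn => [|j IH] jn; first by rewrite (val_inj _ : Ordinal jn = Ordinal n0).
  have jn' : j < n by lia.
  by apply: connect_trans (IH jn') (connect1 _); rewrite /stack_orientation /= eqxx.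
have down j (jn : j < n) : connect stack_orientation (Ordinal jn) (Ordinal n0).
  elim/ltn_ind: j jn => -[|[|j]] IH jn.
  - by rewrite (bool_irrelevance jn n0) connect0.
  (* Vertex 1 cannot step down by two; it reaches 0 by way of vertex 2, which exists since
     [2 < n]. *)
  - apply: (connect_trans (y := Ordinal n_ge3)); apply: connect1;
      by rewrite /stack_orientation.
  - have jn' : j < n by lia.
    apply: connect_trans (connect1 _) (IH j _ jn'); last by lia.
    by rewrite /stack_orientation /= eqxx orbT.
by move=> [i ilt] [j jlt]; exact: connect_trans (down i ilt) (up j jlt).
Qed.

End StackOrientation.

(** * Lower bound on the diameter *)

Lemma path_stack_last n (o : rel 'I_n) u p :
  (forall v w, o v w -> stack_adj v w) -> path o u p ->
  last u p <= u + 3 * size p.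
Proof.
move=> sub; elim: p u => [|v p IH] u /=; first by lia.
move=> /andP[/sub /and3P[_ _ uv] /IH h].
by apply: leq_trans h _; rewrite mulnS; lia.
Qed.

Lemma stack_diameter m n (o : rel 'I_n) : 0 < m -> n = 3 * m ->
  orientation (@stack_adj n) o -> m <= diameter o.
Proof.
move=> m0 nm [sub _].
have n0 : 0 < n by lia.
have nlast : n.-1 < n by lia.
apply: leq_trans (leq_bigmax (Ordinal n0)).
apply: leq_trans (leq_bigmax (Ordinal nlast)).
rewrite /dist leqNgt; apply/negP => lt_m.
set P := fun k => _ in lt_m.
have szE : size (iota 0 #|'I_n|) = n by rewrite size_iota card_ord.
(* A distance below [m], hence below [n], is not the default value of [find], so it comes from an
   actual walk of [k < m] edges. Such a walk ends at index at most [3k <= 3m - 3], short of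
   [3m - 1]. *)
have : has P (iota 0 #|'I_n|) by rewrite has_find szE (leq_trans lt_m) //; lia.
move/(nth_find 0); set k := find _ _ in lt_m *.
rewrite nth_iota; last by rewrite card_ord; lia.
rewrite add0n => /existsP[p /andP[pp /eqP e]].
by have := path_stack_last sub pp; rewrite e size_tuple /=; lia.
Qed.

(** The diameters of strongly connected orientations form a nonempty set of naturals; its least
    element is taken after making membership boolean classically. *)
Lemma oriented_diameter_exists (V : finType) (e o : rel V) :
  orientation e o -> strongly_connected o -> exists d, is_oriented_diameter e d.
Proof.
move=> oo so.
pose P d := `[< exists o' : rel V,
  [/\ orientation e o', strongly_connected o' & diameter o' = d] >].
have exP : exists d, P d by exists (diameter o); apply/asboolP; exists o.
have [d /asboolP Pd dmin] := ex_minnP exP.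
exists d; split=> // o' oo' so'; by apply: dmin; apply/asboolP; exists o'.
Qed.

Theorem theorem3 (R : realType) (n m : nat) (m_gt0 : (0 < m)%N)
    (n_eq : n = (3 * m)%N) :
  exists G : plane_graph R,
    [/\ planar_triangulation G,
        #|G| = n &
        exists d : nat, is_oriented_diameter (@adj R G) d /\
          (n%:R / 3%:R <= d%:R :> rat)%R].
Proof.
have n3 : 3 <= n by lia.
exists (stack_graph R n); split; [exact: stack_triangulation | exact: card_ord |].
have [d hd] := oriented_diameter_exists (stack_orientationP n3)
  (stack_orientation_strong n3).
(* The value [d] is attained by some orientation [ori], to which the diameter bound applies. *)
exists d; split=> //; case: hd => -[ori [ori_adj _ <-]] _.
have -> : (n%:R / 3%:R = m%:R :> rat)%R by rewrite n_eq natrM mulrAC divff // mul1r.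
rewrite ler_nat.
exact: stack_diameter m_gt0 n_eq ori_adj.
Qed.
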